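(* Let $E\subset L_1$ be a quasi-Banach symmetric function space on $(0,1)$. Let $$\mathcal{S}_E=\{x\in L_{1,\infty}(0,1):\ \exists\, y\in E,\ \mu(x)\le S\mu(y)\},\qquad \|x\|_{\mathcal{S}_E}=\inf\{\|y\|_E:\ y\in E,\ \mu(x)\le S\mu(y)\}.$$ Then: (i) $(\mathcal{S}_E,\|\cdot\|_{\mathcal{S}_E})$ is a quasi-Banach symmetric function space on $(0,1)$. (ii) $\mathcal{S}_E$ is the optimal symmetric quasi-Banach range for the operator $S$ on $E$.
   Context: All functions are real-valued measurable functions on $(0,1)$ with Lebesgue measure $m$, identified when equal a.e.; $L_1=L_1(0,1)$. Decreasing rearrangement: $\mu(x)=\mu(\cdot;x)$, $\mu(t;x):=\inf\{s\ge 0: m(\{u:|x(u)|>s\})\le t\}$. A quasi-Banach symmetric function space on $(0,1)$ is a complete quasi-normed space $(E,\|\cdot\|_E)$ of measurable functions on $(0,1)$ such that: if $x\in E$ and $y$ is measurable with $|y|\le|x|$, then $y\in E$ and $\|y\|_E\le\|x\|_E$; if $x\in E$ and $y$ is measurable with $\mu(y)=\mu(x)$, then $y\in E$ and $\|y\|_E=\|x\|_E$. $L_{1,\infty}(0,1)$ is the space of measurable $x$ with $\sup_{0<t\le1}t\mu(t;x)<\infty$. Calderón operator: $(Sx)(t)=\frac1t\int_0^t x(s)\,ds+\int_t^1\frac{x(s)}{s}\,ds$, $x\in L_1$. Optimal range: for a linear operator $R$ defined on $E$, a quasi-Banach symmetric function space $G$ on $(0,1)$ is the optimal symmetric quasi-Banach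 range for $R$ on $E$ if it is the minimal receptacle of $R$ among quasi-Banach symmetric function spaces, i.e. $R:E\to G$ is bounded and $G\subset F$ for every quasi-Banach symmetric function space $F$ on $(0,1)$ such that $R:E\to F$ is bounded. *)

(* Defs.v *)
(* A measurable function on (0,1) is encoded as a function R -> R that is
   measurable on `]0, 1[; its values outside `]0, 1[ are irrelevant.  Instead of
   forming the quotient by a.e. equality, spaces are sets of functions which,
   like their quasi-norms, are invariant under a.e. equality on `]0, 1[.
   Measurability is Borel measurability: every Lebesgue measurable function
   agrees a.e. with a Borel one. *)
From HB Require Import structures.
From mathcomp Require Import all_boot all_order all_algebra.
From mathcomp Require Import all_classical all_reals all_analysis.
Set Implicit Arguments.
Unset Strict Implicit.
Unset Printing Implicit Defensive.
Import Order.TTheory GRing.Theory Num.Theory.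
Import numFieldNormedType.Exports.
Local Open Scope classical_set_scope.
Local Open Scope ring_scope.

Section SymmetricSpaces.
Context {R : realType}.
Implicit Types (x y : R -> R) (E F G : set (R -> R)) (nE nF nG : (R -> R) -> R).

Definition I01 : set R := `]0, 1[%classic.

Definition ae01 (P : R -> Prop) : Prop :=
  {ae (@lebesgue_measure R), forall t, I01 t -> P t}.

Definition L0 : set (R -> R) := [set x | measurable_fun I01 x].

Definition L1 : set (R -> R) :=
  [set x | (@lebesgue_measure R).-integrable I01 (EFin \o x)].

(* Meaningful for t > 0 only: there the set is nonempty (the measure is finite)
   and bounded below, so the real-valued inf is the true infimum, whereas at
   t = 0 the infimum of the empty set is 0 by convention. *)
Definition rearr x (t : R) : R :=
  inf [set s : R | 0 <= s /\
    (lebesgue_measure [set u | I01 u /\ (s < `|x u|)%R] <= t%:E)%E].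

Definition weakL1 : set (R -> R) :=
  [set x | L0 x /\ has_ubound [set t * rearr x t | t in `]0, 1]%classic]].

Definition calderon x (t : R) : R :=
  t^-1 * \int[lebesgue_measure]_(s in `]0, t[) x s
  + \int[lebesgue_measure]_(s in `]t, 1[) (x s / s).

Record quasi_normed E nE : Prop := QuasiNormed {
  qn_measurable : E `<=` L0 ;
  qn_ae : forall x y, E x -> L0 y -> ae01 (fun t => y t = x t) ->
    E y /\ nE y = nE x ;
  qn_zero : E (cst 0) ;
  qn_add : forall x y, E x -> E y -> E (x \+ y) ;
  qn_scale : forall (a : R) x, E x -> E (a \*o x) ;
  qn_ge0 : forall x, E x -> 0 <= nE x ;
  qn_eq0 : forall x, E x -> (nE x = 0 <-> ae01 (fun t => x t = 0)) ;
  qn_homogeneous : forall (a : R) x, E x -> nE (a \*o x) = `|a| * nE x ;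
  qn_triangle : exists C : R, forall x y, E x -> E y ->
    nE (x \+ y) <= C * (nE x + nE y)
}.

Definition quasi_norm_complete E nE : Prop :=
  forall u : nat -> R -> R, (forall n, E (u n)) ->
    (forall e : R, 0 < e -> exists N : nat, forall m n : nat,
      (N <= m)%N -> (N <= n)%N -> nE (u m \- u n) < e) ->
    exists2 x, E x & nE (u n \- x) @[n --> \oo] --> (0 : R).

Record quasi_banach_symmetric E nE : Prop := QuasiBanachSymmetric {
  qbs_quasi_normed : quasi_normed E nE ;
  qbs_complete : quasi_norm_complete E nE ;
  qbs_ideal : forall x y, E x -> L0 y -> ae01 (fun t => `|y t| <= `|x t|) ->
    E y /\ nE y <= nE x ;
  qbs_symmetric : forall x y, E x -> L0 y ->
    (forall t : R, 0 < t < 1 -> rearr y t = rearr x t) ->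
    E y /\ nE y = nE x
}.

Definition linear_on E (T : (R -> R) -> (R -> R)) : Prop :=
  forall (a : R) x y, E x -> E y ->
    ae01 (fun t => T ((a \*o x) \+ y) t = a * T x t + T y t).

Definition bounded_operator (T : (R -> R) -> (R -> R)) E nE F nF : Prop :=
  (forall x, E x -> F (T x)) /\
  exists C : R, forall x, E x -> nF (T x) <= C * nE x.

Record optimal_symmetric_range (T : (R -> R) -> (R -> R)) E nE G nG : Prop :=
  OptimalSymmetricRange {
  osr_linear : linear_on E T ;
  osr_space : quasi_banach_symmetric G nG ;
  osr_bounded : bounded_operator T E nE G nG ;
  osr_minimal : forall F nF, quasi_banach_symmetric F nF ->
    bounded_operator T E nE F nF -> G `<=` F
}.

(* Both sides are defined pointwise on (0,1), the left one being
   right-continuous and, for y in L1, the right one continuous; hence comparing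
   them everywhere or almost everywhere is the same. *)
Definition calderon_dominated x y : Prop :=
  forall t : R, 0 < t < 1 -> rearr x t <= calderon (rearr y) t.

Definition calderon_space E : set (R -> R) :=
  [set x | weakL1 x /\ exists y, E y /\ calderon_dominated x y].

Definition calderon_norm E nE x : R :=
  inf [set nE y | y in [set y | E y /\ calderon_dominated x y]].

End SymmetricSpaces.

(* Main.v *)
Require Import Defs.
From mathcomp Require Import lra.
From HB Require Import structures.
From mathcomp Require Import all_boot all_order all_algebra.
From mathcomp Require Import all_classical all_reals all_analysis measurable_realfun.
Set Implicit Arguments.
Unset Strict Implicit.
Unset Printing Implicit Defensive.
Import Order.TTheory GRing.Theory Num.Theory.
Import numFieldNormedType.Exports.
Local Open Scope classical_set_scope.
Local Open Scope ring_scope.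

(** Write [mu(x)] for the decreasing rearrangement [rearr x] and [S] for the
    Calderon operator. The proof rests on the Galois connection between the distribution function
    and the rearrangement ([rearr_leP]) and on the kernel form of [S],
    namely [S f (t) = int_0^1 f(s) / max(s,t) ds] ([calderonE]). The kernel
    form shows that [S f], for [f >= 0], is nonincreasing, and that
    [S f (c t) <= c^-1 S f (t)] for [0 < c <= 1] ([calderon_dilate]).

    Quasi-norm. If [mu(x1) <= S mu(y1)] and [mu(x2) <= S mu(y2)], then
    [mu(x1 + x2)(t) <= mu(x1)(t/2) + mu(x2)(t/2) <= 2 S mu(y1)(t) + 2 S mu(y2)(t)],
    which is at most [S mu(4 (|y1| + |y2|))(t)]: this is the quasi-triangle
    inequality. That the quasi-norm separates points follows from
    [t mu(x)(t) <= int mu(y) <= K ||y||], where the last step is the continuity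
    of the inclusion of [E] in [L1] ([qbs_embed_L1]).

    Completeness. In [E], a sequence of rapidly decreasing quasi-norms has a
    common majorant ([qbs_majorant]); this also yields the embedding in [L1].
    Given a Cauchy sequence of the Calderon space, a subsequence [v k] has
    increments dominated by [y k] such that [8^k |y k| <= z] almost everywhere
    for one [z] in [E]. Splitting [t] as the sum of the [t / 2^(j+1)] and using
    dilations, the increments beyond rank [M] are geometrically small off a set
    of measure at most [t]. Hence the sequence converges there
    ([rearr_limit_fun]), and its limit differs from [v M] by a function whose
    rearrangement is at most [4 / 8^M S mu(z)].

    Optimality. The Hardy-Littlewood inequality ([hardy_littlewood]), obtained
    from the layer cake formula by comparing superlevel sets with intervals,
    gives [|S x| <= S mu(x)]; as the right-hand side is nonincreasing,
    [mu(S x) <= S mu(x)], that is, [S] is bounded with constant 1. Conversely a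
    symmetric space [F] into which [S] maps [E] contains [S mu(y)] for every [y] in [E], because
    [mu(y)] lies in [E]; so [mu(x) <= S mu(y)] puts [mu(x)], and then [x],
    in [F]. *)

(** * Distribution functions and decreasing rearrangements *)

Section Rearrangement.
Context {R : realType}.
Implicit Types (x y : R -> R) (s t : R).
Local Notation m := (@lebesgue_measure R).

(** The part of (0,1) where [|x|] exceeds [s]; its measure is the distribution
    function of [x] at [s]. *)
Definition superlevel x s : set R := [set u | I01 u /\ s < `|x u|].

Lemma measurable_I01 : measurable (@I01 R).
Proof. exact: measurable_itv. Qed.

Lemma measure_I01 : m I01 = 1%E.
Proof. by rewrite /I01 lebesgue_measure_itv/= lte_fin ltr01 oppr0 adde0. Qed.

Lemma I01P t : I01 t <-> 0 < t < 1.
Proof. by rewrite /I01/= in_itv. Qed.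

Lemma measurable_superlevel x s : L0 x -> measurable (superlevel x s).
Proof.
move=> mx; have mnx : measurable_fun I01 (fun u => `|x u|).
  exact: measurableT_comp.
rewrite (_ : superlevel x s = I01 `&` (fun u => `|x u|) @^-1` `]s, +oo[).
  exact: (mnx measurable_I01).
by apply/seteqP; split=> u /=; rewrite in_itv/= andbT.
Qed.

Lemma superlevel_subset x y s s' : (forall u, I01 u -> `|x u| <= `|y u|) ->
  s' <= s -> superlevel x s `<=` superlevel y s'.
Proof.
move=> xy ss u [u01 su]; split=> //.
by rewrite (le_lt_trans ss)// (lt_le_trans su)// xy.
Qed.

Lemma measure_superlevel_le1 x s : L0 x -> (m (superlevel x s) <= 1)%E.
Proof.
move=> mx; rewrite -measure_I01; apply: le_measure; rewrite ?inE //.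
- exact: measurable_superlevel.
- exact: measurable_I01.
- by move=> u [].
Qed.

Lemma measure_superlevel_fin x s : L0 x -> m (superlevel x s) \is a fin_num.
Proof.
move=> mx; rewrite ge0_fin_numE//.
by rewrite (le_lt_trans (measure_superlevel_le1 _ mx))// ltry.
Qed.

Lemma measure_superlevel_nonincreasing x s s' : L0 x -> s' <= s ->
  (m (superlevel x s) <= m (superlevel x s'))%E.
Proof.
move=> mx ss; apply: le_measure; rewrite ?inE; try exact: measurable_superlevel.
by apply: superlevel_subset => // u _.
Qed.

Lemma measure_superlevel_cvg0 x :
  L0 x -> (m (superlevel x n%:R) @[n --> \oo] --> 0)%E.
Proof.
move=> mx.
have -> : 0%E = m (\bigcap_n superlevel x n%:R).
  rewrite (_ : \bigcap_n _ = set0) ?measure0//; apply/seteqP; split=> // u H.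
  have [_] := H (Num.truncn `|x u|).+1 I.
  by apply/negP; rewrite -leNgt ltW// truncnS_gt.
apply: (@nonincreasing_cvg_mu _ _ _ m (fun n => superlevel x n%:R)).
- by rewrite (le_lt_trans (measure_superlevel_le1 _ mx))// ltry.
- by move=> n; exact: measurable_superlevel.
- by apply: bigcap_measurable => // n _; exact: measurable_superlevel.
- move=> a b ab; rewrite subsetEset; apply: superlevel_subset => //.
  by rewrite ler_nat.
Qed.

Lemma measure_superlevel_right_cvg x s : L0 x ->
  (m (superlevel x (s + n.+1%:R^-1)) @[n --> \oo] --> m (superlevel x s))%E.
Proof.
move=> mx.
have -> : superlevel x s = \bigcup_n superlevel x (s + n.+1%:R^-1).
  apply/seteqP; split=> u /=.
    move=> [u01 su]; have := ltr_add_invr su => -[k ksu].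
    by exists k.
  move=> [n _ [u01 su]]; split=> //; apply: le_lt_trans su.
  by rewrite lerDl.
apply: (@nondecreasing_cvg_mu _ _ _ m (fun n => superlevel x (s + n.+1%:R^-1))).
- by move=> n; exact: measurable_superlevel.
- by apply: bigcup_measurable => n _; exact: measurable_superlevel.
- move=> a b ab; rewrite subsetEset; apply: superlevel_subset => //.
  by rewrite lerD2l lef_pV2 ?posrE// ler_nat.
Qed.

Lemma inf_ge0 (A : set R) : lbound A 0 -> 0 <= inf A.
Proof.
move=> A0; have [->|/set0P A1] := eqVneq A set0; first by rewrite inf0.
exact: lb_le_inf.
Qed.

Lemma rearr_ge0 x t : 0 <= rearr x t.
Proof. by apply: inf_ge0 => s []. Qed.

(** The Galois connection between the rearrangement and the distribution
    function, on which every computation with rearrangements rests. *)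
Lemma rearr_leP x s t : L0 x -> 0 <= s -> 0 < t ->
  rearr x t <= s <-> (m (superlevel x s) <= t%:E)%E.
Proof.
move=> mx s0 t0.
have lb0 : has_lbound [set s | 0 <= s /\ (m (superlevel x s) <= t%:E)%E].
  by exists 0 => r [].
split=> [xs|ms]; last by apply: ge_inf => //.
(* the infimum is attained: every level above [s] belongs to the set, and the
   distribution function is right continuous *)
have ms n : (m (superlevel x (s + n.+1%:R^-1)) <= t%:E)%E.
  have hinf : has_inf [set s | 0 <= s /\ (m (superlevel x s) <= t%:E)%E].
    split=> //.
    have /fine_cvgP[_ /cvgrPdist_lt /(_ _ t0)[N _ /(_ _ (leqnn N))]] :=
      measure_superlevel_cvg0 mx.
    rewrite sub0r normrN => mN; exists N%:R; split=> //.
    rewrite -(fineK (measure_superlevel_fin _ mx)) lee_fin.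
    exact/ltW/(le_lt_trans (ler_norm _) mN).
  have n0 : (0 : R) < n.+1%:R^-1 by [].
  have [r [r0 rt] rs] := inf_adherent n0 hinf.
  apply: le_trans rt; apply: measure_superlevel_nonincreasing => //.
  by rewrite ltW// (lt_le_trans rs)// lerD2r.
apply: (cvge_le _ (measure_superlevel_right_cvg (s := s) mx)).
exact: nearW.
Qed.

Lemma lt_rearrP x s t : L0 x -> 0 <= s -> 0 < t ->
  s < rearr x t <-> (t%:E < m (superlevel x s))%E.
Proof.
move=> mx s0 t0; rewrite !ltNge.
have e := rearr_leP mx s0 t0.
split; (apply: contra => /e //); by move/e.
Qed.

Lemma rearr_nonincreasing x t t' : L0 x -> 0 < t -> t <= t' ->
  rearr x t' <= rearr x t.
Proof.
move=> mx t0 tt; apply/rearr_leP => //; first exact: rearr_ge0.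
  exact: lt_le_trans tt.
rewrite (@le_trans _ _ t%:E)//; apply/rearr_leP => //; exact: rearr_ge0.
Qed.

Lemma ae01_superlevel_le x y s : L0 x -> L0 y ->
  ae01 (fun t => `|x t| <= `|y t|) ->
  (m (superlevel x s) <= m (superlevel y s))%E.
Proof.
move=> mx my [N [mN N0 xyN]].
rewrite (@le_trans _ _ (m (superlevel y s `|` N)))//; last first.
  apply: (le_trans (measureU2 _ _ _)) => //; first exact: measurable_superlevel.
  rewrite [X in (_ + X)%E](_ : _ = 0%E) ?adde0//.
apply: le_measure; rewrite ?inE.
- exact: measurable_superlevel.
- by apply: measurableU => //; exact: measurable_superlevel.
- move=> u [u01 su]; have [Nu|Nu] := pselect (N u); [by right|left].
  split=> //; apply: (lt_le_trans su); apply: contrapT => xy; apply: Nu.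
  by apply: xyN => /= /(_ u01).
Qed.

Lemma le_rearr x y t : L0 x -> L0 y -> ae01 (fun t => `|x t| <= `|y t|) ->
  0 < t -> rearr x t <= rearr y t.
Proof.
move=> mx my xy t0; apply/rearr_leP => //; first exact: rearr_ge0.
rewrite (le_trans (ae01_superlevel_le _ mx my xy))//.
apply/rearr_leP => //; exact: rearr_ge0.
Qed.

Lemma ae01W (P : R -> Prop) : (forall t, I01 t -> P t) -> ae01 P.
Proof. by move=> PT; exact: aeW. Qed.

Lemma ae01_mono (P Q : R -> Prop) :
  (forall t, I01 t -> P t -> Q t) -> ae01 P -> ae01 Q.
Proof.
move=> PQ [N [mN N0 PN]]; exists N; split=> // t /= Qt; apply: PN => /= Pt.
by apply: Qt => t01; apply: (PQ _ t01) (Pt t01).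
Qed.

Lemma eq_rearr x y t : L0 x -> L0 y -> ae01 (fun t => x t = y t) ->
  0 < t -> rearr x t = rearr y t.
Proof.
move=> mx my xy t0; apply/eqP; rewrite eq_le; apply/andP; split.
  by apply: le_rearr => //; apply: ae01_mono xy => u _ ->.
by apply: le_rearr => //; apply: ae01_mono xy => u _ ->.
Qed.

Lemma L0D x y : L0 x -> L0 y -> L0 (x \+ y).
Proof. by move=> mx my; exact: measurable_funD. Qed.

Lemma L0B x y : L0 x -> L0 y -> L0 (x \- y).
Proof. by move=> mx my; exact: measurable_funB. Qed.

Lemma L0Z a x : L0 x -> L0 (a \*o x).
Proof. by move=> mx; exact: measurable_funM. Qed.

Lemma L0_norm x : L0 x -> L0 (fun t => `|x t|).
Proof. by move=> mx; exact: measurableT_comp. Qed.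

Lemma rearr0 t : 0 < t -> rearr (cst 0) t = 0 :> R.
Proof.
move=> t0; apply/eqP; rewrite eq_le rearr_ge0 andbT.
apply/rearr_leP => //; first exact: measurable_cst.
rewrite (_ : superlevel _ _ = set0) ?measure0 ?lee_fin ?ltW//.
by apply/seteqP; split=> // u [_]; rewrite normr0 ltxx.
Qed.

Lemma rearrZ_le a x t : L0 x -> 0 < t -> rearr (a \*o x) t <= `|a| * rearr x t.
Proof.
move=> mx t0; apply/rearr_leP => //; first exact: L0Z.
  by rewrite mulr_ge0// rearr_ge0.
apply: (@le_trans _ _ (m (superlevel x (rearr x t)))); last first.
  apply/rearr_leP => //; exact: rearr_ge0.
apply: le_measure; rewrite ?inE; [|exact: measurable_superlevel|].
  by apply: measurable_superlevel; exact: L0Z.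
move=> u [u01]; rewrite /= normrM => au; split=> //.
by rewrite ltNge; apply: contraL au => xu; rewrite -leNgt ler_wpM2l.
Qed.

Lemma rearrZ a x t : L0 x -> 0 < t -> rearr (a \*o x) t = `|a| * rearr x t.
Proof.
move=> mx t0; apply/eqP; rewrite eq_le rearrZ_le//=.
have [->|a0] := eqVneq a 0; first by rewrite normr0 mul0r rearr_ge0.
rewrite -ler_pdivlMl ?normr_gt0// -normfV.
apply: le_trans (rearrZ_le a^-1 (L0Z a mx) t0).
rewrite (_ : a^-1 \*o _ = x)//; apply/funext => u /=.
by rewrite mulKf.
Qed.

Lemma rearrD x y t t' : L0 x -> L0 y -> 0 < t -> 0 < t' ->
  rearr (x \+ y) (t + t') <= rearr x t + rearr y t'.
Proof.
move=> mx my t0 t'0.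
apply/rearr_leP; rewrite ?addr_gt0//; first exact: L0D.
  by rewrite addr_ge0// rearr_ge0.
apply: (@le_trans _ _ (m (superlevel x (rearr x t) `|` superlevel y (rearr y t')))).
  apply: le_measure; rewrite ?inE.
  - by apply: measurable_superlevel; exact: L0D.
  - by apply: measurableU; exact: measurable_superlevel.
  - move=> u [u01 /= xy]; have [xu|xu] := ltP (rearr x t) `|x u|; first by left.
    right; split=> //; rewrite ltNge; apply: contraL xy => yu.
    by rewrite -leNgt (le_trans (ler_normD _ _))// lerD.
apply: (le_trans (measureU2 _ _ _)); try exact: measurable_superlevel.
rewrite EFinD leeD//; apply/rearr_leP => //; exact: rearr_ge0.
Qed.

Lemma measurable_nonincreasing01 (f : R -> R) :
  (forall s t, 0 < s -> s <= t -> t < 1 -> f t <= f s) -> L0 f.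
Proof.
move=> fni; apply: (measurability (@RGenCInfty.G R)) => [|/= _ [_] [r] -> <-].
  exact: RGenCInfty.measurableE.
apply: is_interval_measurable => s t [/I01P/andP[s0 _] fs].
move=> [/I01P/andP[_ t1] ft] u /andP[su ut].
move: fs ft; rewrite /= !in_itv/= !andbT => fs ft.
have u0 := lt_le_trans s0 su; have u1 := le_lt_trans ut t1.
by split; [exact/I01P/andP|rewrite (le_trans ft)// fni].
Qed.

Lemma L0_rearr x : L0 x -> L0 (rearr x).
Proof.
move=> mx; apply: measurable_nonincreasing01 => s t s0 st _.
exact: rearr_nonincreasing.
Qed.

(** The superlevel sets of the rearrangement are the intervals (0,a) of the same
    measure as those of the function; this is equimeasurability. *)
Lemma superlevel_rearr x s : L0 x -> 0 <= s ->
  superlevel (rearr x) s = `]0, fine (m (superlevel x s))[%classic.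
Proof.
move=> mx s0; have mf := measure_superlevel_fin s mx.
apply/seteqP; split=> u /=.
  rewrite /superlevel/= ger0_norm ?rearr_ge0// => -[/I01P/andP[u0 _]].
  by move=> /(lt_rearrP mx s0 u0); rewrite in_itv/= u0 -lte_fin fineK.
rewrite in_itv/= => /andP[u0]; rewrite -lte_fin fineK// => um.
split; last by rewrite ger0_norm ?rearr_ge0//; exact/lt_rearrP.
apply/I01P; rewrite u0/= -lte_fin.
exact: (lt_le_trans um (measure_superlevel_le1 _ mx)).
Qed.

Lemma measure_superlevel_rearr x s : L0 x -> 0 <= s ->
  m (superlevel (rearr x) s) = m (superlevel x s).
Proof.
move=> mx s0; have mf := measure_superlevel_fin s mx.
rewrite superlevel_rearr// lebesgue_measure_itv/= lte_fin.
case: ltgtP (fine_ge0 (measure_ge0 m (superlevel x s))) => [h _|//|h _].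
  by rewrite oppr0 adde0 fineK.
by rewrite -[RHS]fineK// -h.
Qed.

Lemma rearr_rearr x t : L0 x -> 0 < t -> rearr (rearr x) t = rearr x t.
Proof.
move=> mx t0; apply/eqP; rewrite eq_le; apply/andP; split.
  apply/(rearr_leP (L0_rearr mx) (rearr_ge0 _ _) t0).
  rewrite measure_superlevel_rearr ?rearr_ge0//.
  by apply/rearr_leP => //; exact: rearr_ge0.
apply/(rearr_leP mx (rearr_ge0 _ _) t0).
rewrite -measure_superlevel_rearr ?rearr_ge0//.
by apply/rearr_leP; rewrite ?rearr_ge0//; exact: L0_rearr.
Qed.

(** A nonincreasing function bounding [|x|] on (0,1) bounds the rearrangement. *)
Lemma rearr_le_nonincreasing x (f : R -> R) t : L0 x ->
  (forall s t, 0 < s -> s <= t -> t < 1 -> f t <= f s) ->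
  (forall u, I01 u -> `|x u| <= f u) -> 0 < t < 1 -> rearr x t <= f t.
Proof.
move=> mx fni xf /andP[t0 t1].
have ft0 : 0 <= f t by rewrite (le_trans _ (xf t _))//; apply/I01P/andP.
apply/rearr_leP => //.
apply: (@le_trans _ _ (m `]0, t[%classic)).
  apply: le_measure; rewrite ?inE//; first exact: measurable_superlevel.
  move=> u [u01 fu]; rewrite /= in_itv/=.
  have /I01P/andP[u0 u1] := u01; rewrite u0/= ltNge.
  apply: contraL fu => tu; rewrite -leNgt (le_trans (xf _ u01))//.
  exact: fni.
by rewrite lebesgue_measure_itv/= lte_fin t0 oppr0 adde0.
Qed.

End Rearrangement.

(** * The Calderon operator as an integral operator *)

Section CalderonKernel.
Context {R : realType}.
Implicit Types (x y f g : R -> R) (s t : R).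
Local Notation m := (@lebesgue_measure R).

Lemma L1_L0 x : L1 x -> L0 x.
Proof. by move=> /integrableP[/measurable_EFinP]. Qed.

Lemma L1_dominated x y : L0 x -> L1 y -> (forall t, I01 t -> `|x t| <= `|y t|) ->
  L1 x.
Proof.
move=> mx iy xy; apply: (@le_integrable _ _ _ m _ measurable_I01 _ (EFin \o y)) => //.
exact/measurable_EFinP.
Qed.

Lemma L1_norm x : L1 x -> L1 (fun t => `|x t|).
Proof.
move=> ix; apply: (L1_dominated _ ix); first exact: (L0_norm (L1_L0 ix)).
by move=> t _; rewrite normr_id.
Qed.

Lemma L1D x y : L1 x -> L1 y -> L1 (x \+ y).
Proof.
move=> ix iy.
by have := @integrableD _ _ _ m _ measurable_I01 (EFin \o x) (EFin \o y) ix iy.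
Qed.

Lemma L1Z a x : L1 x -> L1 (a \*o x).
Proof.
move=> ix.
by have := @integrableZl _ _ _ m _ measurable_I01 a (EFin \o x) ix.
Qed.

Lemma L1B x y : L1 x -> L1 y -> L1 (x \- y).
Proof.
move=> ix iy.
by have := @integrableB _ _ _ m _ measurable_I01 (EFin \o x) (EFin \o y) ix iy.
Qed.

Lemma integrable_subitv x (i : interval R) : L1 x -> [set` i] `<=` I01 ->
  m.-integrable [set` i] (EFin \o x).
Proof.
move=> ix i01.
by apply: (@integrableS _ _ _ m I01) => //; exact: measurable_I01.
Qed.

Lemma max_gt0 s t : 0 < t -> 0 < Num.max s t.
Proof. by rewrite lt_max => ->; rewrite orbT. Qed.

Lemma L0_kernel t : L0 (fun s => (Num.max s t)^-1).
Proof.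
have [t0|t0] := ltP 0 t.
  apply: measurable_nonincreasing01 => r s r0 rs s1.
  rewrite lef_pV2 ?posrE ?max_gt0// ge_max le_max rs/=.
  by rewrite le_max lexx orbT.
apply: measurable_nonincreasing01 => r s r0 rs s1.
have s0 := lt_le_trans r0 rs.
rewrite !(max_idPl _)//; try exact: (le_trans t0 (ltW _)).
by rewrite lef_pV2 ?posrE.
Qed.

Lemma L1_kernel f t : L1 f -> 0 < t -> L1 (fun s => f s / Num.max s t).
Proof.
move=> i_f t0; apply: (@L1_dominated _ (t^-1 \*o f)).
- by apply: measurable_funM; [exact: L1_L0|exact: L0_kernel].
- exact: L1Z.
- move=> s s01 /=; rewrite !normrM mulrC ler_wpM2r//.
  rewrite !normfV lef_pV2 ?posrE ?normr_gt0 ?gt_eqF ?max_gt0//.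
  by rewrite !gtr0_norm ?max_gt0// le_max lexx orbT.
Qed.

(** On (0,1) the Calderon operator is the integral operator with kernel
    [1 / max(s,t)]. *)
Lemma calderonE f t : L1 f -> 0 < t < 1 ->
  calderon f t = \int[m]_(s in I01) (f s / Num.max s t).
Proof.
move=> i_f /andP[t0 t1]; have ik := L1_kernel i_f t0.
rewrite /I01 (@itv_bndbnd_setU _ _ _ (BLeft t)) ?bnd_simp ?ltW//.
rewrite Rintegral_setU//=; last 2 first.
  - by rewrite -itv_bndbnd_setU ?bnd_simp ?ltW//.
  - apply/disj_setPS => y [/=]; rewrite 2!in_itv/= => /andP[_ yx] /andP[].
    by rewrite leNgt yx.
rewrite -Rintegral_itv_obnd_cbnd; last first.
  by apply: (integrable_subitv ik); apply: subset_itvr; rewrite bnd_simp ltW.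
congr (_ + _); last first.
  apply: eq_Rintegral => s; rewrite inE/= in_itv/= => /andP[ts s1].
  by rewrite (max_idPl (ltW ts)).
rewrite -RintegralZl//; last first.
  by apply: (integrable_subitv i_f); apply: subset_itvl; rewrite bnd_simp ltW.
apply: eq_Rintegral => s; rewrite inE/= in_itv/= => /andP[ts s1].
by rewrite (max_idPr (ltW s1)) mulrC.
Qed.

Lemma le_calderon f g t : L1 f -> L1 g -> (forall s, I01 s -> f s <= g s) ->
  0 < t < 1 -> calderon f t <= calderon g t.
Proof.
move=> i_f ig fg t01; have /andP[t0 _] := t01.
rewrite !calderonE//; apply: le_Rintegral; try exact: L1_kernel.
  exact: measurable_I01.
by move=> s s01; rewrite ler_wpM2r ?fg// invr_ge0 ltW// max_gt0.
Qed.

Lemma calderonZ a f t : L1 f -> 0 < t < 1 ->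
  calderon (a \*o f) t = a * calderon f t.
Proof.
move=> i_f t01; have /andP[t0 _] := t01; rewrite !calderonE//; last exact: L1Z.
rewrite -RintegralZl; [|exact: measurable_I01|exact: L1_kernel].
by apply: eq_Rintegral => s _; rewrite -mulrA.
Qed.

Lemma calderonD f g t : L1 f -> L1 g -> 0 < t < 1 ->
  calderon (f \+ g) t = calderon f t + calderon g t.
Proof.
move=> i_f ig t01; have /andP[t0 _] := t01; rewrite !calderonE//; last exact: L1D.
rewrite -RintegralD; try exact: L1_kernel; last exact: measurable_I01.
by apply: eq_Rintegral => s _; rewrite -mulrDl.
Qed.

Lemma calderon_ge0 f t : (forall s, I01 s -> 0 <= f s) -> 0 < t < 1 ->
  0 <= calderon f t.
Proof.
move=> f0 /andP[t0 t1]; rewrite addr_ge0// ?mulr_ge0 ?invr_ge0 ?(ltW t0)//.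
  apply: Rintegral_ge0 => s; rewrite /= in_itv/= => /andP[s0 st].
  by apply/f0/I01P; rewrite s0 (lt_trans st).
apply: Rintegral_ge0 => s; rewrite /= in_itv/= => /andP[ts s1].
have s0 := lt_trans t0 ts.
by rewrite divr_ge0 ?(ltW s0)//; apply/f0/I01P; rewrite s0.
Qed.

Lemma calderon_nonincreasing f s t : L1 f -> (forall s, I01 s -> 0 <= f s) ->
  0 < s -> s <= t -> t < 1 -> calderon f t <= calderon f s.
Proof.
move=> i_f f0 s0 st t1; have t0 := lt_le_trans s0 st.
rewrite !calderonE ?s0 ?t0 ?(le_lt_trans st)//.
apply: le_Rintegral; try exact: L1_kernel; first exact: measurable_I01.
move=> r r01; rewrite ler_wpM2l ?f0// lef_pV2 ?posrE ?max_gt0//.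
by rewrite ge_max !le_max lexx st orbT.
Qed.

(** Contracting the argument by [c] costs at most a factor [c^-1], because
    [c * max(s,t) <= max(s, c * t)]. *)
Lemma calderon_dilate f c t : L1 f -> (forall s, I01 s -> 0 <= f s) ->
  0 < c <= 1 -> 0 < t < 1 -> calderon f (c * t) <= c^-1 * calderon f t.
Proof.
move=> i_f f0 /andP[c0 c1] /andP[t0 t1]; have ct0 : 0 < c * t by rewrite mulr_gt0.
have ct1 : c * t < 1 by rewrite (le_lt_trans _ t1)// ler_piMl// ltW.
rewrite !calderonE ?t0 ?ct0//.
rewrite -RintegralZl; [|exact: measurable_I01|exact: L1_kernel].
apply: le_Rintegral; first exact: measurable_I01.
- exact: L1_kernel.
- by apply: L1Z; exact: L1_kernel.
move=> r r01; rewrite mulrCA ler_wpM2l ?f0// -invfM.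
rewrite lef_pV2 ?posrE ?mulr_gt0 ?max_gt0//.
have /I01P/andP[r0 _] := r01.
rewrite maxr_pMr ?(ltW c0)// ge_max !le_max lexx orbT andbT.
by rewrite ler_piMl// ltW.
Qed.

Lemma le_calderon_norm1 f t : L1 f -> (forall s, I01 s -> 0 <= f s) ->
  0 < t < 1 -> t * calderon f t <= \int[m]_(s in I01) f s.
Proof.
move=> i_f f0 /andP[t0 t1]; rewrite calderonE ?t0//.
rewrite -RintegralZl; [|exact: measurable_I01|exact: L1_kernel].
apply: le_Rintegral => //; first exact: measurable_I01.
  by apply: L1Z; exact: L1_kernel.
move=> r r01; rewrite mulrCA ler_piMr ?f0// ler_pdivrMr ?max_gt0// mul1r.
by rewrite le_max lexx orbT.
Qed.

Lemma L0_calderon f : L1 f -> L0 (calderon f).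
Proof.
move=> i_f.
(* a difference of two Calderon transforms of nonnegative functions, both
   nonincreasing *)
pose p s := `|f s|; pose n s := `|f s| - f s.
have ip : L1 p by exact: L1_norm.
have i_n : L1 n by exact: (L1B ip).
have p0 s : 0 <= p s by rewrite /p.
have n0 s : 0 <= n s by rewrite subr_ge0 ler_norm.
have m_p : L0 (calderon p).
  by apply: measurable_nonincreasing01 => s t; apply: calderon_nonincreasing => //.
have mn : L0 (calderon n).
  by apply: measurable_nonincreasing01 => s t; apply: calderon_nonincreasing => //.
apply: (eq_measurable_fun (calderon p \- calderon n)); last exact: L0B.
move=> t; rewrite inE => /I01P t01; apply/eqP; rewrite subr_eq -calderonD//.
by apply/eqP; congr (calderon _ t); apply/funext => s /=; rewrite addrC subrK.
Qed.

End CalderonKernel.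

(** * The Hardy-Littlewood inequality *)

Section HardyLittlewood.
Context {R : realType}.
Implicit Types (x y f g k : R -> R) (s t : R).
Local Notation m := (@lebesgue_measure R).

(** The weight [k s] carried by the region [0 <= l < |f s|] of the plane; its
    integrals along the two axes are the two sides of the layer cake formula. *)
Let cake_fun f k (p : measurableTypeR R * measurableTypeR R) : \bar R :=
  ((k \_ I01) p.1 * \1_(`[0, ((fun s => `|f s|) \_ I01) p.1[%classic : set R) p.2)%:E.

Let measurable_cake f k : L0 f -> L0 k -> measurable_fun setT (cake_fun f k).
Proof.
move=> mf mk; pose h : R -> R := (fun s => `|f s|) \_ I01.
have mh : measurable_fun setT h.
  by apply/(measurable_restrictT _ measurable_I01); exact: L0_norm.
have mk1 : measurable_fun setT (k \_ I01).
  exact/(measurable_restrictT _ measurable_I01).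
apply/measurable_EFinP; apply: measurable_funM.
  exact: (measurableT_comp mk1 measurable_fst).
pose GR := measurableTypeR R.
pose E := [set p : GR * GR | (0 <= (p.2 : R)) && ((p.2 : R) < h p.1)].
have mE : measurable E.
  pose fsnd (p : GR * GR) := (0 <= (p.2 : R)).
  pose f21 (p : GR * GR) := ((p.2 : R) < h p.1).
  rewrite [X in measurable X](_ : _ =
      fsnd @^-1` [set true] `&` f21 @^-1` [set true]); last first.
    by apply/seteqP; split => p /= => [/andP//|[? ?]]; exact/andP.
  apply: measurableI.
  - have : measurable_fun setT fsnd by exact: measurable_fun_ler.
    by move=> /(_ measurableT [set true]); rewrite setTI; exact.
  - have : measurable_fun setT f21.
      apply: measurable_fun_ltr; first exact: measurable_snd.
      exact: (measurableT_comp mh measurable_fst).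
    by move=> /(_ measurableT [set true]); rewrite setTI; exact.
have := @measurable_indic _ _ R setT E mE.
apply: eq_measurable_fun => p _.
by rewrite !indicE; congr (nat_of_bool _)%:R; apply/idP/idP; rewrite !inE/= in_itv.
Qed.

Let cake_fun_ge0 f k p : (forall s, I01 s -> 0 <= k s) -> (0 <= cake_fun f k p)%E.
Proof.
move=> k0; rewrite /cake_fun lee_fin mulr_ge0 ?indicE// patchE.
by case: ifPn => //; rewrite inE => /k0.
Qed.

Let cake_slice f k l : 0 <= l ->
  (\int[m]_s cake_fun f k (s, l) = \int[m]_(s in superlevel f l) (k s)%:E)%E.
Proof.
move=> l0; rewrite [RHS]integral_mkcond; apply: eq_integral => s _.
rewrite /cake_fun/= !patchE indicE.
case: ifPn => s01; last first.
  rewrite mul0r memNset//= => -[s01' _]; move: s01; rewrite notin_setE; exact.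
have [lf|lf] := ltP l `|f s|.
  by rewrite !mem_set ?mulr1//=; [split=> //; exact: set_mem|rewrite in_itv/= l0].
rewrite !memNset ?mulr0//=; first by move=> [_]; rewrite ltNge lf.
by rewrite in_itv/= l0/= ltNge lf.
Qed.

Lemma measurable_layer f k : L0 f -> L0 k -> (forall s, I01 s -> 0 <= k s) ->
  measurable_fun (`[0, +oo[%classic : set R) (fun l => \int[m]_(s in superlevel f l) (k s)%:E)%E.
Proof.
move=> mf mk k0.
have mG : measurable_fun setT (fun l => \int[m]_s cake_fun f k (s, l))%E.
  apply: (measurable_fun_fubini_tonelli_G (cake_fun f k)).
    exact: measurable_cake.
  by move=> p; exact: cake_fun_ge0.
apply: (eq_measurable_fun (fun l => \int[m]_s cake_fun f k (s, l))%E).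
  by move=> l; rewrite inE/= in_itv/= andbT => l0; exact: cake_slice.
exact: measurable_funTS.
Qed.

(** The layer cake formula for the measure of density [k]. *)
Lemma layer_cake f k : L0 f -> L0 k -> (forall s, I01 s -> 0 <= k s) ->
  (\int[m]_(s in I01) (`|f s| * k s)%:E =
   \int[m]_(l in `[0%R, +oo[) \int[m]_(s in superlevel f l) (k s)%:E)%E.
Proof.
move=> mf mk k0.
have kg0 s : 0 <= (k \_ I01) s.
  by rewrite patchE; case: ifPn => //; rewrite inE => /k0.
transitivity (\int[m]_s \int[m]_l cake_fun f k (s, l))%E.
  rewrite integral_mkcond; apply: eq_integral => s _.
  rewrite /cake_fun/=; under eq_integral do rewrite EFinM.
  rewrite ge0_integralZl_EFin//=; last first.
    by apply/measurable_EFinP; apply: measurable_indic.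
  rewrite integral_indic//= setIT lebesgue_measure_itv/= lte_fin.
  rewrite !patchE; case: ifPn => s01; last by rewrite mul0e.
  case: ltgtP (normr_ge0 (f s)) => // [f0 _|<- _]; last by rewrite mule0 mul0r.
  by rewrite oppr0 adde0 -EFinM mulrC.
rewrite (fubini_tonelli (cake_fun f k))//=; last 2 first.
- exact: measurable_cake.
- by move=> p; exact: cake_fun_ge0.
rewrite [RHS]integral_mkcond; apply: eq_integral => l _.
rewrite patchE; case: ifPn => l0; last first.
  apply: integral0_eq => s _; rewrite /cake_fun/= indicE memNset ?mulr0//=.
  by rewrite in_itv/=; apply/negP; apply: contra l0 => /andP[l0 _]; rewrite inE/= in_itv/= l0.
move: l0; rewrite inE/= in_itv/= andbT => l0.
exact: cake_slice.
Qed.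

(** Among the sets of measure [a] in (0,1), the interval (0,a) maximises the
    integral of a nonincreasing nonnegative function. *)
Lemma bathtub k (A : set R) (a : R) : measurable A -> A `<=` I01 -> a <= 1 ->
  m A = a%:E -> L0 k -> (forall s, 0 <= k s) ->
  (forall s s', 0 < s -> s <= s' -> k s' <= k s) ->
  (\int[m]_(s in A) (k s)%:E <= \int[m]_(s in `]0%R, a[) (k s)%:E)%E.
Proof.
move=> mA A01 a1 mAa mk k0 kni.
have a0 : 0 <= a by rewrite -lee_fin -mAa.
have mkA : measurable_fun A (EFin \o k).
  by apply: (measurable_funS measurable_I01 A01); exact/measurable_EFinP.
(* the comparison with [k a] below makes sense for [a > 0] only *)
have [a_eq0|ane0] := eqVneq a 0.
  have mA0 : m A = 0%E by rewrite mAa a_eq0.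
  rewrite (@null_set_integral _ _ _ m A)//.
  by apply: integral_ge0 => s _; rewrite lee_fin.
have {ane0}a_gt0 : 0 < a by rewrite lt_def ane0.
pose B : set R := `]0, a[%classic.
have mB : measurable B by exact: measurable_itv.
have mBa : m B = a%:E by rewrite lebesgue_measure_itv/= lte_fin a_gt0 oppr0 adde0.
have B01 : B `<=` I01.
  move=> s; rewrite /B/= in_itv/= => /andP[s0 sa]; apply/I01P.
  by rewrite s0 (lt_le_trans sa).
have mkB : measurable_fun B (EFin \o k).
  by apply: (measurable_funS measurable_I01 B01); exact/measurable_EFinP.
(* [A] and [B] having the same measure, only the parts outside their
   intersection matter; there [k] is at most, resp. at least, [k a] *)
have mAB : m (A `\` B) = m (B `\` A).
  have fI : m (A `&` B) \is a fin_num.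
    rewrite ge0_fin_numE// (@le_lt_trans _ _ (m A))//; last by rewrite mAa ltry.
    by apply: le_measure; rewrite ?inE//; first [exact: measurableI|exact: subIsetl].
  have : (m (A `\` B) + m (A `&` B) = m (B `\` A) + m (A `&` B))%E.
    by rewrite -measureDI// [in RHS]setIC -measureDI// [LHS]mAa.
  by move=> /(congr1 (fun z => z - m (A `&` B))%E); rewrite !addeK.
have split_int (X Y : set R) : measurable X -> measurable Y ->
    measurable_fun X (EFin \o k) ->
    (\int[m]_(s in X) (k s)%:E = \int[m]_(s in X `&` Y) (k s)%:E
      + \int[m]_(s in X `\` Y) (k s)%:E)%E.
  move=> mX mY mkX; rewrite -{1}(setUIDK X Y) ge0_integral_setU//.
  - exact: measurableI.
  - exact: measurableD.
  - by rewrite setUIDK.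
  - by move=> s _; rewrite lee_fin.
  - by apply/disj_setPS => s [[_ Ys] []].
rewrite (split_int A B)// -/B (split_int B A)// (setIC B A) leeD2l//.
apply: (@le_trans _ _ (\int[m]_(s in A `\` B) (k a)%:E)%E).
  apply: ge0_le_integral => //.
  - exact: measurableD.
  - by move=> s _; rewrite lee_fin.
  - by apply: measurable_funS mkA => // s [].
  - move=> s [As Bs]; rewrite lee_fin kni//.
    have /I01P/andP[s0 _] := A01 _ As.
    by rewrite leNgt; apply/negP => sa; apply: Bs; rewrite /B/= in_itv/= s0.
have -> : (\int[m]_(s in A `\` B) (k a)%:E = \int[m]_(s in B `\` A) (k a)%:E)%E.
  rewrite !integral_cst; try exact: measurableD.
  by congr (_ * _)%E; exact: mAB.
apply: ge0_le_integral => //.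
- exact: measurableD.
- by move=> s _; rewrite lee_fin.
- by apply: measurable_funS mkB => // s [].
- move=> s []; rewrite /B/= in_itv/= => /andP[s0 sa] _; rewrite lee_fin.
  by rewrite kni// ltW.
Qed.

(** The Hardy-Littlewood inequality for a nonincreasing weight. *)
Lemma hardy_littlewood x k : L0 x -> L0 k -> (forall s, 0 <= k s) ->
  (forall s s', 0 < s -> s <= s' -> k s' <= k s) ->
  (\int[m]_(s in I01) (`|x s| * k s)%:E <=
   \int[m]_(s in I01) (`|rearr x s| * k s)%:E)%E.
Proof.
move=> mx mk k0 kni; have mrx := L0_rearr mx.
rewrite !layer_cake//.
have mlayer f : L0 f -> measurable_fun (`[0, +oo[%classic : set R)
    (fun l => \int[m]_(s in superlevel f l) (k s)%:E)%E.
  by move=> mf; apply: measurable_layer.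
apply: ge0_le_integral => //.
- by move=> l _; apply: integral_ge0 => s _; rewrite lee_fin.
- exact: mlayer.
- exact: mlayer.
- move=> l; rewrite /= in_itv/= andbT => l0.
  rewrite superlevel_rearr//; apply: bathtub => //.
  + exact: measurable_superlevel.
  + by move=> s [].
  + rewrite -lee_fin fineK; first exact: measure_superlevel_le1.
    exact: measure_superlevel_fin.
  + by rewrite fineK//; exact: measure_superlevel_fin.
Qed.

End HardyLittlewood.

Section RearrCalderon.
Context {R : realType}.
Implicit Types (x y f g k : R -> R) (s t : R).
Local Notation m := (@lebesgue_measure R).

(** The Hardy-Littlewood inequality for the kernel of the Calderon operator. *)
Lemma norm_calderon_le x t : L1 x -> L1 (rearr x) -> 0 < t < 1 ->
  `|calderon x t| <= calderon (rearr x) t.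
Proof.
move=> ix irx t01; have /andP[t0 _] := t01; rewrite !calderonE//.
pose k s := (Num.max s t)^-1.
have k0 s : 0 <= k s by rewrite invr_ge0 ltW// max_gt0.
have iabs f : L1 f -> L1 (fun s => `|f s| * k s).
  by move=> i_f; apply: L1_kernel => //; exact: L1_norm.
have fin f : L1 f -> (\int[m]_(s in I01) (`|f s| * k s)%:E)%E \is a fin_num.
  by move=> /iabs h; apply: integrable_fin_num => //; exact: measurable_I01.
apply: (le_trans (le_normr_Rintegral _ _)); first exact: measurable_I01.
  exact: L1_kernel.
rewrite (@eq_Rintegral _ _ _ m _ (fun s => `|x s| * k s)); last first.
  by move=> s _; rewrite normrM (ger0_norm (k0 s)).
rewrite [leRHS](@eq_Rintegral _ _ _ m _ (fun s => `|rearr x s| * k s)); last first.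
  by move=> s _; rewrite (ger0_norm (rearr_ge0 _ _)).
rewrite /Rintegral fine_le ?fin//.
apply: hardy_littlewood => //; first exact: L1_L0.
  exact: L0_kernel.
move=> r s r0 rs; rewrite lef_pV2 ?posrE ?max_gt0//.
by rewrite ge_max !le_max rs lexx orbT.
Qed.

Lemma rearr_calderon_le x t : L1 x -> L1 (rearr x) -> 0 < t < 1 ->
  rearr (calderon x) t <= calderon (rearr x) t.
Proof.
move=> ix irx; apply: rearr_le_nonincreasing; first exact: L0_calderon.
  move=> r s r0 rs s1; apply: calderon_nonincreasing => // u _.
  exact: rearr_ge0.
by move=> u /I01P u01; exact: norm_calderon_le.
Qed.

Lemma ae01_le_norm1 x y : L1 x -> L1 y -> ae01 (fun t => `|x t| <= `|y t|) ->
  \int[m]_(s in I01) `|x s| <= \int[m]_(s in I01) `|y s|.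
Proof.
move=> ix iy xy; have fin f : L1 f -> (\int[m]_(s in I01) `|f s|%:E)%E \is a fin_num.
  move=> /L1_norm h; apply: integrable_fin_num => //; exact: measurable_I01.
rewrite /Rintegral fine_le ?fin//.
apply: ae_ge0_le_integral => //; first exact: measurable_I01.
- by apply/measurable_EFinP; apply: L0_norm; exact: L1_L0.
- by apply/measurable_EFinP; apply: L0_norm; exact: L1_L0.
Qed.

Lemma norm1Z a x : L1 x ->
  \int[m]_(s in I01) `|a * x s| = `|a| * \int[m]_(s in I01) `|x s|.
Proof.
move=> ix; rewrite -RintegralZl; [|exact: measurable_I01|exact: L1_norm].
by apply: eq_Rintegral => s _; rewrite normrM.
Qed.

End RearrCalderon.

(** * Quasi-Banach symmetric spaces *)

Section QuasiNormed.
Context {R : realType} (E : set (R -> R)) (nE : (R -> R) -> R).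
Hypothesis qnE : quasi_normed E nE.
Implicit Types (x y : R -> R).

Lemma qn_B x y : E x -> E y -> E (x \- y).
Proof.
move=> Ex Ey; rewrite (_ : x \- y = x \+ ((-1) \*o y)).
  by apply: (qn_add qnE) => //; exact: (qn_scale qnE).
by apply/funext => t /=; rewrite mulN1r.
Qed.

Lemma qn_normB x y : E x -> E y -> nE (x \- y) = nE (y \- x).
Proof.
move=> Ex Ey; rewrite (_ : y \- x = (-1) \*o (x \- y)).
  by rewrite (qn_homogeneous qnE) ?normrN1 ?mul1r//; exact: qn_B.
by apply/funext => t /=; rewrite mulN1r opprB.
Qed.

(** The constant of the quasi-triangle inequality can be taken at least 1. *)
Lemma qn_triangle_ge1 : exists2 C : R, 1 <= C &
  forall x y, E x -> E y -> nE (x \+ y) <= C * (nE x + nE y).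
Proof.
have [C HC] := qn_triangle qnE; exists (Num.max C 1).
  by rewrite le_max lexx orbT.
move=> x y Ex Ey; apply: (le_trans (HC _ _ Ex Ey)).
by rewrite ler_wpM2r ?le_max ?lexx// addr_ge0//; exact: (qn_ge0 qnE).
Qed.

End QuasiNormed.

Section SymmetricSpaceTheory.
Context {R : realType} (E : set (R -> R)) (nE : (R -> R) -> R).
Hypothesis symE : quasi_banach_symmetric E nE.
Implicit Types (x y z : R -> R) (s t : R).
Local Notation m := (@lebesgue_measure R).

Let qnE : quasi_normed E nE := qbs_quasi_normed symE.

Lemma qbs_L0 x : E x -> L0 x.
Proof. exact: (qn_measurable qnE). Qed.

Lemma qbs_norm x : E x -> E (fun t => `|x t|) /\ nE (fun t => `|x t|) = nE x.
Proof.
move=> Ex; have mx := qbs_L0 Ex; have mnx := L0_norm mx.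
have [Ea nEa] : E (fun t => `|x t|) /\ nE (fun t => `|x t|) <= nE x.
  by apply: (qbs_ideal symE Ex mnx); apply: ae01W => t _; rewrite normr_id.
have [_ nEb] : E x /\ nE x <= nE (fun t => `|x t|).
  by apply: (qbs_ideal symE Ea mx); apply: ae01W => t _; rewrite normr_id.
by split=> //; apply/eqP; rewrite eq_le nEa.
Qed.

Lemma qbs_rearr x : E x -> E (rearr x) /\ nE (rearr x) = nE x.
Proof.
move=> Ex; have mx := qbs_L0 Ex.
apply: (qbs_symmetric symE Ex); first exact: L0_rearr.
by move=> t /andP[t0 _]; rewrite rearr_rearr.
Qed.

(** A function belongs to a symmetric space as soon as its rearrangement does. *)
Lemma qbs_rearrK x : L0 x -> E (rearr x) -> E x.
Proof.
move=> mx Erx; have [] // := qbs_symmetric symE Erx mx.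
by move=> t /andP[t0 _]; rewrite rearr_rearr.
Qed.

(** A rapidly decreasing sequence of [E] has a common majorant in [E], namely
    the sum of the series of absolute values. *)
Lemma qbs_majorant : exists2 q : R, 0 < q < 1 & forall y : nat -> R -> R,
  (forall k, E (y k)) -> (forall k, nE (y k) <= q ^+ k) ->
  exists2 z, E z & forall k, ae01 (fun t => `|y k t| <= z t).
Proof.
have [C C1 HC] := qn_triangle_ge1 qnE.
have C0 : 0 < C by apply: lt_le_trans C1.
pose q : R := (2 * C)^-1.
have q0 : 0 < q by rewrite invr_gt0 mulr_gt0.
have qC : 2 * C * q = 1 by rewrite divff// gt_eqF// mulr_gt0.
have q1 : q < 1.
  rewrite invf_lt1 ?mulr_gt0//.
  by rewrite (lt_le_trans (_ : 1 < 2))// ?ltr1n// ler_peMr.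
exists q => [|y Ey yq]; first exact/andP.
(* the partial sums of the series of absolute values *)
pose S := fix S n : R -> R :=
  if n is n'.+1 then S n' \+ (fun t => `|y n' t|) else cst 0.
have ES n : E (S n).
  elim: n => [|n IHn]; first exact: (qn_zero qnE).
  by apply: (qn_add qnE) => //; have [] := qbs_norm (Ey n).
(* by induction on [j]: [C * (q ^ n + 2 * C * q ^ n.+1) = 2 * C * q ^ n] *)
have SD n j : nE (S (n + j)%N \- S n) <= 2 * C * q ^+ n.
  elim: j n => [|j IHj] n.
    rewrite addn0 (_ : S n \- S n = cst 0); last first.
      by apply/funext => t /=; rewrite subrr.
    have /(qn_eq0 qnE)[_ ->] := qn_zero qnE; last exact: ae01W.
    by rewrite mulr_ge0 ?exprn_ge0 ?mulr_ge0 ?(ltW C0) ?(ltW q0).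
  rewrite (_ : _ \- _ = (fun t => `|y n t|) \+ (S (n.+1 + j)%N \- S n.+1)); last first.
    by apply/funext => t; rewrite addnS addSn /=; lra.
  have [En nEn] := qbs_norm (Ey n).
  apply: (le_trans (HC _ _ En (qn_B qnE (ES _) (ES _)))).
  rewrite nEn.
  apply: (@le_trans _ _ (C * (q ^+ n + 2 * C * q ^+ n.+1))).
    by rewrite ler_wpM2l ?(ltW C0)// lerD.
  have -> : 2 * C * q ^+ n.+1 = q ^+ n by rewrite exprS mulrA qC mul1r.
  lra.
have Sle n j t : S n t <= S (n + j)%N t.
  by elim: j => [|j IHj]; rewrite ?addn0// addnS/= (le_trans IHj)// lerDl.
have cq : (2 * C * q ^+ n) @[n --> \oo] --> (0 : R).
  by rewrite -(mulr0 (2 * C)); apply: cvgMr; apply: cvg_expr; rewrite gtr0_norm.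
have [|z Ez zS] := qbs_complete symE ES.
  move=> e e0; have /cvgrPdist_lt/(_ _ e0)[N _ HN] := cq.
  have key p n : (N <= n)%N -> (n <= p)%N -> nE (S p \- S n) < e.
    move=> Nn np; rewrite -(subnKC np); apply: (le_lt_trans (SD _ _)).
    have := HN n Nn; rewrite sub0r normrN; exact/le_lt_trans/ler_norm.
  exists N => p n Np Nn; have [np|pn] := leqP n p; first exact: key.
  by rewrite (qn_normB qnE)//; apply: key => //; exact: ltnW.
exists z => // k.
(* the positive part of [S k.+1 - z] is bounded by [|S n - z|] for all large
   [n], so that its quasi-norm vanishes *)
pose w t := Num.max (S k.+1 t - z t) 0.
have mz := qbs_L0 Ez.
have mw : L0 w.
  apply: measurable_maxr; last exact: measurable_cst.
  by apply: L0B => //; exact: qbs_L0.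
have wle j : E w /\ nE w <= nE (S (k.+1 + j)%N \- z).
  apply: (qbs_ideal symE _ mw); first exact: (qn_B qnE).
  apply: ae01W => t _; rewrite /w /=; have := Sle k.+1 j t.
  have [h _|h] := leP (S k.+1 t - z t) 0; first by rewrite normr0.
  move=> Sj; have Sz : S k.+1 t - z t <= S (k.+1 + j)%N t - z t by rewrite lerD2r.
  by rewrite gtr0_norm// gtr0_norm// (lt_le_trans h Sz).
have Ew := (wle 0%N).1.
have nw : nE w = 0.
  apply/eqP; rewrite eq_le (qn_ge0 qnE Ew) andbT.
  have zS' : nE (S (k.+1 + j)%N \- z) @[j --> \oo] --> (0 : R).
    have := zS; rewrite -(cvg_shiftn k.+1) => h.
    by under eq_fun do rewrite addnC; exact: h.
  apply: (cvgr_to_ge zS'); apply: nearW => j; exact: (wle j).2.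
have /(qn_eq0 qnE Ew) : nE w = 0 by [].
apply: ae01_mono => t _; rewrite /w.
have [h _|h e] := leP (S k.+1 t - z t) 0; last by move: h; rewrite e ltxx.
move: h; rewrite subr_le0; apply: le_trans => /=.
rewrite lerDr; elim: {Ew nw wle mw w} k => //= k IHk.
by rewrite addr_ge0.
Qed.

(** A symmetric space contained in [L1] embeds continuously in [L1]. *)
Lemma qbs_embed_L1 : E `<=` L1 -> exists2 K : R, 0 <= K &
  forall y, E y -> \int[m]_(s in I01) `|y s| <= K * nE y.
Proof.
move=> EL1; apply: contrapT => nK.
(* otherwise there are functions of rapidly decreasing quasi-norm and unbounded
   [L1] norm, which a common majorant in [L1] excludes *)
have [q /andP[q0 _] maj] := qbs_majorant.
have exy k : exists y, E y /\ nE y <= q ^+ k /\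
    k%:R < \int[m]_(s in I01) `|y s|.
  pose K : R := k%:R / q ^+ k.
  have K0 : 0 <= K by rewrite divr_ge0// exprn_ge0// ltW.
  have [y [Ey yK]] : exists y, E y /\ K * nE y < \int[m]_(s in I01) `|y s|.
    apply: contrapT => noy; apply: nK; exists K => // y Ey.
    by rewrite leNgt; apply/negP => yK; apply: noy; exists y.
  have ny0 : 0 < nE y.
    rewrite lt_def (qn_ge0 qnE Ey) andbT; apply/negP => /eqP ny0.
    move: yK; rewrite ny0 mulr0; apply/negP; rewrite -leNgt.
    have /(qn_eq0 qnE Ey) y0 := ny0.
    have iy := EL1 _ Ey; have i0 : L1 (cst 0 : R -> R) by exact/EL1/(qn_zero qnE).
    apply: (@le_trans _ _ (\int[m]_(s in I01) `|(cst 0 : R -> R) s|)).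
      by apply: ae01_le_norm1 => //; apply: ae01_mono y0 => t _ ->.
    by under eq_Rintegral do rewrite normr0; rewrite Rintegral_cst ?mul0r//; exact: measurable_I01.
  pose c := q ^+ k / nE y.
  have c0 : 0 < c by rewrite divr_gt0// exprn_gt0.
  exists (c \*o y); split; first exact: (qn_scale qnE).
  rewrite (qn_homogeneous qnE)// gtr0_norm// divfK ?gt_eqF//; split=> //.
  rewrite norm1Z; last exact: EL1.
  rewrite gtr0_norm// mulrC -ltr_pdivrMr//; apply: le_lt_trans yK.
  by rewrite /K /c invf_div mulrA mulrAC.
have [y Hy] := choice exy.
have [||z Ez yz] := maj y; [by move=> k; have [] := Hy k|by move=> k; have [_ []] := Hy k|].
have iz := EL1 _ Ez.
pose N := (Num.truncn (\int[m]_(s in I01) `|z s|)).+1.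
have [EyN [_ /lt_le_trans yN]] := Hy N.
have : N%:R < \int[m]_(s in I01) `|z s|.
  apply: yN; apply: ae01_le_norm1 => //; first exact: EL1.
  by apply: ae01_mono (yz N) => t _ h; rewrite (le_trans h)// ler_norm.
by apply/negP; rewrite -leNgt ltW// truncnS_gt.
Qed.

End SymmetricSpaceTheory.

(** * Limits of sequences with rearrangement control *)

Section RearrangementLimit.
Context {R : realType}.
Implicit Types (x y z : R -> R) (s t : R) (v : nat -> R -> R).
Local Notation m := (@lebesgue_measure R).

Lemma geometric_increments_cvg (a : nat -> R) (B : R) :
  (forall j, `|a j.+1 - a j| <= B * 2^-1 ^+ j) ->
  exists2 l, a n @[n --> \oo] --> l & `|l - a 0%N| <= 2 * B.
Proof.
move=> aB; have h1 : `|2^-1 : R| < 1 by rewrite ger0_norm// invf_lt1// ltr1n.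
have cg := @cvg_geometric_series R B 2^-1 h1.
have ct : cvgn [normed series (telescope a)].
  apply: (@series_le_cvg _ (fun j => `|telescope a j|) (geometric B 2^-1)) => //.
    by move=> j; rewrite (le_trans _ (aB j)).
  exact: is_cvg_geometric_series.
have cs : cvgn (series (telescope a)) by exact: normed_cvg.
exists (limn (series (telescope a)) + a 0%N).
  have e n : a n = series (telescope a) n + a 0%N.
    by rewrite [LHS]eq_sum_telescope addrC.
  by rewrite (eq_cvg _ _ e); apply: cvgD => //; exact: cvg_cst.
rewrite addrK; apply: (le_trans (lim_series_norm ct)).
have -> : 2 * B = limn (series (geometric B 2^-1)).
  rewrite (cvg_lim _ cg)// [X in X - _](splitr 1) div1r addrK invrK.
  exact: mulrC.
apply: lim_series_le => //.
exact: is_cvg_geometric_series.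
Qed.

(** The pointwise upper limit of a sequence of functions, with value 0 where it
    is infinite. *)
Definition limit_fun v t : R := fine (limn_esup (fun n => (v n t)%:E)).

Lemma L0_limit_fun v : (forall n, L0 (v n)) -> L0 (limit_fun v).
Proof.
move=> mv; apply: (measurableT_comp (@fine_measurable R setT measurableT)) => //.
apply: measurable_fun_limn_esup => n; apply/measurable_EFinP; exact: mv.
Qed.

Lemma limit_funE v t (l : R) : v n t @[n --> \oo] --> l -> limit_fun v t = l.
Proof.
move=> vl; rewrite /limit_fun.
have vlE : (v n t)%:E @[n --> \oo] --> l%:E.
  by apply: cvg_EFin; [exact: nearW|exact: vl].
by have [_ ->] := cvg_limn_einf_sup vlE.
Qed.

(** The increments of rank [M + j] are at most [B * 2^-j] off a set of measure at
    most [t / 2^(j+1)]. These measures add up to [t], and off the union of the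
    sets the sequence converges to a limit at distance at most [2 * B] from its
    term of rank [M]. *)
Lemma rearr_limit_fun v M t (B : R) : (forall n, L0 (v n)) -> 0 < t -> 0 <= B ->
  (forall j, rearr (v (M + j).+1 \- v (M + j)%N) (t / (2 ^ j.+1)%:R)
    <= B * 2^-1 ^+ j) ->
  rearr (limit_fun v \- v M) t <= 2 * B.
Proof.
move=> mv t0 B0 vB; have ml := L0_limit_fun mv.
pose A j := superlevel (v (M + j).+1 \- v (M + j)%N) (B * 2^-1 ^+ j).
have mA j : measurable (A j) by apply: measurable_superlevel; exact: L0B.
have t2 j : 0 < t / (2 ^ j.+1)%:R by rewrite divr_gt0// ltr0n expn_gt0.
have mAt j : (m (A j) <= (t / (2 ^ j.+1)%:R)%:E)%E.
  apply/rearr_leP => //; first exact: L0B.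
  by rewrite mulr_ge0// exprn_ge0.
apply/rearr_leP => //; [exact: L0B|by rewrite mulr_ge0|].
apply: (@le_trans _ _ (m (\bigcup_j A j))).
  apply: le_measure; rewrite ?inE.
  - by apply: measurable_superlevel; exact: L0B.
  - by apply: bigcup_measurable => j _; exact: mA.
  - move=> u [u01 /= vu]; apply: contrapT => nA.
    have inc j : `|v (M + j.+1)%N u - v (M + j)%N u| <= B * 2^-1 ^+ j.
      by rewrite leNgt addnS; apply/negP => h; apply: nA; exists j => //.
    have [l vl] := geometric_increments_cvg inc.
    rewrite addn0 => lB.
    have ul : v n u @[n --> \oo] --> l.
      rewrite -(cvg_shiftn M) /=.
      by under eq_fun do rewrite addnC; exact: vl.
    by move: vu; rewrite (limit_funE ul) ltNge lB.
apply: (le_trans (generalized_Boole_inequality _ _ _)) => //.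
  by apply: bigcup_measurable => j _; exact: mA.
apply: (le_trans _ (epsilon_trick0 xpredT (ltW t0))).
by apply: lee_nneseries => [j _ _|j _]; [exact: measure_ge0|exact: mAt].
Qed.

End RearrangementLimit.

(** * The Calderon space *)

Section CalderonSpace.
Context {R : realType} (E : set (R -> R)) (nE : (R -> R) -> R).
Hypothesis symE : quasi_banach_symmetric E nE.
Hypothesis EL1 : E `<=` L1.
Implicit Types (x y z : R -> R) (s t : R).
Local Notation m := (@lebesgue_measure R).
Local Notation G := (calderon_space E).
Local Notation nG := (calderon_norm E nE).

Let qnE : quasi_normed E nE := qbs_quasi_normed symE.

Let E_L0 y : E y -> L0 y. Proof. exact: (qbs_L0 symE). Qed.

Let L1_rearr y : E y -> L1 (rearr y).
Proof. by move=> Ey; apply: EL1; have [] := qbs_rearr symE Ey. Qed.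

Let calderon_rearr_ge0 y t : 0 < t < 1 -> 0 <= calderon (rearr y) t.
Proof. by apply: calderon_ge0 => s _; exact: rearr_ge0. Qed.

Let calderon_rearrZ a y t : E y -> 0 < t < 1 ->
  calderon (rearr (a \*o y)) t = `|a| * calderon (rearr y) t.
Proof.
move=> Ey t01; have iy := L1_rearr Ey.
have iay := L1_rearr (qn_scale qnE a Ey).
rewrite -calderonZ//; apply/eqP; rewrite eq_le.
have e s : I01 s -> rearr (a \*o y) s = `|a| * rearr y s.
  by move=> /I01P/andP[s0 _]; rewrite rearrZ//; exact: E_L0.
have iaz : L1 (`|a| \*o rearr y) by exact: L1Z.
by apply/andP; split; apply: le_calderon => // s s01; rewrite e.
Qed.

Let dominated_rearr_le x y t : E y -> calderon_dominated x y -> 0 < t < 1 ->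
  t * rearr x t <= \int[m]_(s in I01) `|rearr y s|.
Proof.
move=> Ey xy t01; have /andP[t0 t1] := t01.
apply: (@le_trans _ _ (t * calderon (rearr y) t)).
  by rewrite ler_wpM2l ?(ltW t0)// xy.
rewrite (@eq_Rintegral _ _ _ m I01 (rearr y)).
  apply: le_calderon_norm1 => //; first exact: L1_rearr.
  by move=> s _; exact: rearr_ge0.
by move=> s _; rewrite ger0_norm// rearr_ge0.
Qed.

(** Membership in weak [L1] is implied by domination. *)
Lemma calderon_spaceP x :
  G x <-> L0 x /\ exists y, E y /\ calderon_dominated x y.
Proof.
split=> [[[mx _] xy] //|[mx [y [Ey xy]]]]; split; last by exists y.
split=> //; exists (\int[m]_(s in I01) `|rearr y s|) => _ [t /= + <-].
rewrite in_itv/= => /andP[t0]; rewrite le_eqVlt => /orP[/eqP ->|t1].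
  rewrite mul1r (@le_trans _ _ 0)//; last by apply: Rintegral_ge0.
  apply/rearr_leP => //; exact: measure_superlevel_le1.
by apply: dominated_rearr_le => //; rewrite t0.
Qed.

Let G_L0 x : G x -> L0 x. Proof. by move=> /calderon_spaceP[]. Qed.

Lemma calderon_spaceI x y : L0 x -> E y -> calderon_dominated x y -> G x.
Proof. by move=> mx Ey xy; apply/calderon_spaceP; split=> //; exists y. Qed.

Let norm_lb x : lbound [set nE y | y in [set y | E y /\ calderon_dominated x y]] 0.
Proof. by move=> _ [y [Ey _] <-]; exact: (qn_ge0 qnE). Qed.

Lemma calderon_norm_ge0 x : 0 <= nG x.
Proof. exact/inf_ge0/norm_lb. Qed.

Lemma calderon_norm_le x y : E y -> calderon_dominated x y -> nG x <= nE y.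
Proof.
move=> Ey xy; apply: ge_inf; first by exists 0; exact: norm_lb.
by exists y.
Qed.

Lemma le_calderon_norm x (c : R) : G x ->
  (forall y, E y -> calderon_dominated x y -> c <= nE y) -> c <= nG x.
Proof.
move=> /calderon_spaceP[_ [y [Ey xy]]] cx; apply: lb_le_inf.
  by exists (nE y), y.
by move=> _ [y' [Ey' xy'] <-]; exact: cx.
Qed.

Lemma calderon_norm_lt x (c : R) : G x -> nG x < c ->
  exists y, [/\ E y, calderon_dominated x y & nE y < c].
Proof.
move=> Gx xc; apply: contrapT => H; move: xc; apply/negP; rewrite -leNgt.
apply: le_calderon_norm => // y Ey xy; rewrite leNgt; apply/negP => yc.
by apply: H; exists y.
Qed.

Lemma calderon_space_mono x x' : G x -> L0 x' ->
  (forall t, 0 < t < 1 -> rearr x' t <= rearr x t) -> G x' /\ nG x' <= nG x.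
Proof.
move=> Gx mx' xx'.
have dom y : calderon_dominated x y -> calderon_dominated x' y.
  by move=> xy t t01; rewrite (le_trans (xx' _ t01))// xy.
split; last first.
  by apply: le_calderon_norm => // y Ey xy; apply: calderon_norm_le => //; exact: dom.
have /calderon_spaceP[_ [y [Ey xy]]] := Gx.
by apply: calderon_spaceI Ey _ => //; exact: dom.
Qed.

Let eq_calderon_space x x' : G x -> L0 x' ->
  (forall t, 0 < t < 1 -> rearr x' t = rearr x t) -> G x' /\ nG x' = nG x.
Proof.
move=> Gx mx' xx'; have [Gx' le1] : G x' /\ nG x' <= nG x.
  by apply: calderon_space_mono => // t /xx' ->.
have [_ le2] : G x /\ nG x <= nG x'.
  by apply: calderon_space_mono => // [|t /xx' ->//]; exact: G_L0.
by split=> //; apply/eqP; rewrite eq_le le1.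
Qed.

Let dominatedZ a x y : L0 x -> E y -> calderon_dominated x y ->
  calderon_dominated (a \*o x) (a \*o y).
Proof.
move=> mx Ey xy t t01; have /andP[t0 _] := t01.
by rewrite rearrZ// calderon_rearrZ// ler_wpM2l// xy.
Qed.

(** Halving [t] in the two rearrangements costs a factor 2, and bounding both
    [y] and [y'] by [|y| + |y'|] another factor 2. *)
Let dominatedD x x' y y' : L0 x -> L0 x' -> E y -> E y' ->
  calderon_dominated x y -> calderon_dominated x' y' ->
  calderon_dominated (x \+ x') (4 \*o ((fun t => `|y t|) \+ (fun t => `|y' t|))).
Proof.
move=> mx mx' Ey Ey' xy xy' t t01; have /andP[t0 t1] := t01.
pose Y := (fun t => `|y t|) \+ (fun t => `|y' t|); rewrite -/Y.
have EY : E Y.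
  by apply: (qn_add qnE); [have [] := qbs_norm symE Ey|have [] := qbs_norm symE Ey'].
have h0 : 0 < 2^-1 * t by rewrite mulr_gt0.
have h1 : 0 < 2^-1 * t < 1 by rewrite h0/=; lra.
rewrite calderon_rearrZ// normr_nat.
have half u : E u -> (forall s, `|u s| <= `|Y s|) ->
    calderon (rearr u) (2^-1 * t) <= 2 * calderon (rearr Y) t.
  move=> Eu uY; have h : 0 < (2^-1 : R) <= 1 by lra.
  apply: (le_trans (calderon_dilate (L1_rearr Eu) _ h t01)).
    by move=> s _; exact: rearr_ge0.
  rewrite invrK; apply: ler_wpM2l; first by rewrite ler0n.
  apply: le_calderon; [exact: L1_rearr|exact: L1_rearr| |exact: t01].
  move=> s /I01P/andP[s0 _].
  apply: le_rearr; [exact: E_L0|exact: E_L0| |exact: s0].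
  by apply: ae01W => r _; exact: uY.
have -> : t = 2^-1 * t + 2^-1 * t by lra.
apply: (le_trans (rearrD mx mx' h0 h0)).
have -> : 2^-1 * t + 2^-1 * t = t by lra.
have yY : calderon (rearr y) (2^-1 * t) <= 2 * calderon (rearr Y) t.
  apply: half => // s; rewrite /Y/= [leRHS]ger0_norm; last exact: addr_ge0.
  by rewrite lerDl.
have yY' : calderon (rearr y') (2^-1 * t) <= 2 * calderon (rearr Y) t.
  apply: half => // s; rewrite /Y/= [leRHS]ger0_norm; last exact: addr_ge0.
  by rewrite lerDr.
apply: (le_trans (lerD (le_trans (xy _ h1) yY) (le_trans (xy' _ h1) yY'))).
by rewrite -mulrDl -natrD.
Qed.

Lemma calderon_space_zero : G (cst 0) /\ nG (cst 0) = 0.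
Proof.
have E0 := qn_zero qnE.
have d0 : calderon_dominated (cst 0 : R -> R) (cst 0).
  by move=> t t01; have /andP[t0 _] := t01; rewrite rearr0//; exact: calderon_rearr_ge0.
split; first by apply: calderon_spaceI E0 d0; exact: measurable_cst.
apply/eqP; rewrite eq_le calderon_norm_ge0 andbT.
rewrite (le_trans (calderon_norm_le E0 d0))//.
by have [_ ->] := qn_eq0 qnE E0; last exact: ae01W.
Qed.

Lemma calderon_space_scale a x : G x -> G (a \*o x).
Proof.
move=> /calderon_spaceP[mx [y [Ey xy]]].
apply: (calderon_spaceI (y := a \*o y)); first exact: L0Z.
  exact: (qn_scale qnE).
exact: dominatedZ.
Qed.

Let calderon_normZ_le a x : a != 0 -> G x -> nG (a \*o x) <= `|a| * nG x.
Proof.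
move=> a0 Gx; have na0 : 0 < `|a| by rewrite normr_gt0.
rewrite -ler_pdivrMl//; apply: le_calderon_norm => // y Ey xy.
rewrite ler_pdivrMl// -(qn_homogeneous qnE)//; apply: calderon_norm_le.
  exact: (qn_scale qnE).
by apply: dominatedZ => //; exact: G_L0.
Qed.

Lemma calderon_normZ a x : G x -> nG (a \*o x) = `|a| * nG x.
Proof.
move=> Gx; have [->|a0] := eqVneq a 0.
  rewrite normr0 mul0r (_ : _ \*o x = cst 0); first exact: calderon_space_zero.2.
  by apply/funext => t /=; rewrite mul0r.
apply/eqP; rewrite eq_le calderon_normZ_le//=.
rewrite -ler_pdivlMl ?normr_gt0// -normfV.
apply: le_trans (calderon_normZ_le _ _); last 2 first.
- by rewrite invr_eq0.
- exact: calderon_space_scale.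
rewrite (_ : a^-1 \*o (a \*o x) = x)//.
by apply/funext => u /=; rewrite mulKf.
Qed.

Lemma calderon_space_add x x' : G x -> G x' -> G (x \+ x').
Proof.
move=> /calderon_spaceP[mx [y [Ey xy]]] /calderon_spaceP[mx' [y' [Ey' xy']]].
apply: calderon_spaceI (dominatedD mx mx' Ey Ey' xy xy'); first exact: L0D.
apply: (qn_scale qnE); apply: (qn_add qnE).
  by have [] := qbs_norm symE Ey.
by have [] := qbs_norm symE Ey'.
Qed.

Lemma calderon_norm_triangle : exists C : R, forall x x', G x -> G x' ->
  nG (x \+ x') <= C * (nG x + nG x').
Proof.
have [C C1 HC] := qn_triangle_ge1 qnE; exists (4 * C) => x x' Gx Gx'.
have C0 : 0 < 4 * C by rewrite mulr_gt0// (lt_le_trans _ C1).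
rewrite -ler_pdivrMl// -lerBlDr; apply: le_calderon_norm => // y Ey xy.
rewrite lerBlDr -lerBlDl; apply: le_calderon_norm => // y' Ey' xy'.
rewrite lerBlDl ler_pdivrMl//.
have [Ea ea] := qbs_norm symE Ey; have [Ea' ea'] := qbs_norm symE Ey'.
have ED := qn_add qnE Ea Ea'.
apply: (le_trans (calderon_norm_le (qn_scale qnE 4 ED)
  (dominatedD (G_L0 Gx) (G_L0 Gx') Ey Ey' xy xy'))).
rewrite (qn_homogeneous qnE)// normr_nat -mulrA ler_wpM2l//.
by rewrite -ea -ea'; exact: HC.
Qed.

(** The Calderon space embeds continuously in weak [L1]. *)
Lemma calderon_norm_weakL1 : exists2 K : R, 0 <= K &
  forall x t, G x -> 0 < t < 1 -> t * rearr x t <= K * nG x.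
Proof.
have [K K0 HK] := qbs_embed_L1 symE EL1; exists (K + 1) => [|x t Gx t01].
  by rewrite addr_ge0.
have K1 : 0 < K + 1 by rewrite ltr_wpDl.
rewrite -ler_pdivrMl//; apply: le_calderon_norm => // y Ey xy.
rewrite ler_pdivrMl//; have [Er er] := qbs_rearr symE Ey.
apply: (le_trans (dominated_rearr_le Ey xy t01)).
apply: (le_trans (HK _ Er)); rewrite er ler_wpM2r ?lerDl//.
exact: (qn_ge0 qnE).
Qed.

Let rearr_eq0 x : L0 x -> (forall t, 0 < t < 1 -> rearr x t <= 0) ->
  ae01 (fun t => x t = 0).
Proof.
move=> mx x0; exists (superlevel x 0); split.
- exact: measurable_superlevel.
- apply/eqP; rewrite -measure_le0; apply/lee_addgt0Pr => e e0.
  rewrite add0e; pose d := Num.min e 2^-1.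
  have d01 : 0 < d < 1.
    by rewrite lt_min e0 gt_min invf_lt1// ltr1n orbT/= invr_gt0 ltr0n.
  apply: (@le_trans _ _ d%:E); last by rewrite lee_fin ge_min lexx.
  by have /andP[d0 _] := d01; apply/rearr_leP => //; exact: x0.
- move=> t /= H; apply: contrapT => nx; apply: H => t01; apply: contrapT => xt.
  by apply: nx; split=> //; rewrite normr_gt0; exact/eqP.
Qed.

Lemma calderon_norm_eq0 x : G x -> (nG x = 0 <-> ae01 (fun t => x t = 0)).
Proof.
move=> Gx; have mx := G_L0 Gx; split=> [x0|x0].
  have [K K0 HK] := calderon_norm_weakL1.
  apply: rearr_eq0 => // t t01; have /andP[t0 _] := t01.
  by have := HK _ _ Gx t01; rewrite x0 mulr0 pmulr_rle0.
have [G0 n0] := calderon_space_zero.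
rewrite -n0; apply: (eq_calderon_space G0 mx _).2 => t /andP[t0 _].
by apply: eq_rearr => //; exact: measurable_cst.
Qed.

Lemma calderon_quasi_normed : quasi_normed G nG.
Proof.
split.
- by move=> x /G_L0.
- move=> x y Gx my xy; apply: eq_calderon_space => // t /andP[t0 _].
  by apply: eq_rearr => //; exact: G_L0.
- exact: calderon_space_zero.1.
- exact: calderon_space_add.
- exact: calderon_space_scale.
- by move=> x _; exact: calderon_norm_ge0.
- exact: calderon_norm_eq0.
- exact: calderon_normZ.
- exact: calderon_norm_triangle.
Qed.

(** Along a subsequence with increments dominated by [y k], where
    [z >= 8 ^ k |y k|] lies in [E], the tails are dominated by multiples of this
    single [z] tending to 0. *)
Lemma calderon_complete : quasi_norm_complete G nG.
Proof.
have qnG := calderon_quasi_normed.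
move=> u Gu Cu; have [q /andP[q0 q1] maj] := qbs_majorant symE.
(* small enough for [8 ^ k y k] to have quasi-norm at most [q ^ k] *)
pose e k := (q / 8) ^+ k.
have e0 k : 0 < e k by rewrite exprn_gt0// divr_gt0.
have [N HN] := choice (fun k => Cu (e k) (e0 k)).
pose phi := fix phi k : nat := if k is k'.+1 then (phi k' + N k)%N else N 0%N.
have Nphi k : (N k <= phi k)%N by case: k => [|k] //=; exact: leq_addl.
have Nphi1 k : (N k <= phi k.+1)%N.
  by rewrite (leq_trans (Nphi k))//=; exact: leq_addr.
pose v k := u (phi k); have Gv k : G (v k) by exact: Gu.
pose w k := v k.+1 \- v k; have Gw k : G (w k) by exact: (qn_B qnG).
have ey k : exists y, [/\ E y, calderon_dominated (w k) y & nE y < e k].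
  by apply: calderon_norm_lt => //; exact: HN.
have [y Hy] := choice ey.
have Ey k : E (y k) by have [] := Hy k.
pose yc k := 8 ^+ k \*o y k.
have Eyc k : E (yc k) by exact: (qn_scale qnE).
have [|z Ez yz] := maj yc Eyc.
  move=> k; rewrite (qn_homogeneous qnE)// ger0_norm ?exprn_ge0//.
  have [_ _ /ltW yk] := Hy k.
  apply: (@le_trans _ _ (8 ^+ k * e k)); first by rewrite ler_wpM2l ?exprn_ge0.
  by rewrite -exprMn mulrCA divff ?mulr1.
have yS k t : 0 < t < 1 ->
    calderon (rearr (y k)) t <= (8 ^+ k)^-1 * calderon (rearr z) t.
  move=> t01; rewrite ler_pdivlMl ?exprn_gt0//.
  have -> : 8 ^+ k * calderon (rearr (y k)) t = calderon (rearr (yc k)) t.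
    by rewrite /yc (calderon_rearrZ _ (Ey k) t01) ger0_norm ?exprn_ge0.
  apply: le_calderon; [exact: L1_rearr|exact: L1_rearr| |exact: t01].
  move=> s /I01P/andP[s0 _].
  apply: le_rearr; [exact: E_L0|exact: E_L0| |exact: s0].
  by apply: ae01_mono (yz k) => r _ h; rewrite (le_trans h)// ler_norm.
have mv k : L0 (v k) by exact: G_L0.
pose x := limit_fun v.
have mx : L0 x by exact: L0_limit_fun.
have key M : calderon_dominated (x \- v M) ((4 / 8 ^+ M) \*o z).
  move=> t t01; have /andP[t0 t1] := t01; rewrite (calderon_rearrZ _ Ez t01).
  rewrite ger0_norm ?divr_ge0 ?exprn_ge0//.
  pose B := 2 / 8 ^+ M * calderon (rearr z) t.
  have -> : 4 / 8 ^+ M * calderon (rearr z) t = 2 * B.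
    by rewrite /B !mulrA -natrM.
  have Sz := calderon_rearr_ge0 z t01.
  apply: rearr_limit_fun => //.
    by rewrite /B !mulr_ge0// invr_ge0 exprn_ge0.
  (* evaluating at [t / c] loses the factor [c], for which the gain
     [8 ^ (M + j)] more than compensates *)
  move=> j; set c : R := (2 ^ j.+1)%:R.
  have c1 : 1 <= c by rewrite /c ler1n expn_gt0.
  have c0 : 0 < c by exact: lt_le_trans c1.
  have h01 : 0 < c^-1 * t < 1.
    by rewrite mulr_gt0 ?invr_gt0//= (le_lt_trans _ t1)// ler_piMl ?(ltW t0)// invf_le1.
  rewrite (mulrC t); have [_ wy _] := Hy (M + j)%N.
  apply: (le_trans (wy _ h01)).
  have hc : 0 < c^-1 <= 1 by rewrite invr_gt0 c0 invf_le1.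
  apply: (le_trans (calderon_dilate (L1_rearr (Ey _)) _ hc t01)).
    by move=> s _; exact: rearr_ge0.
  rewrite invrK.
  apply: (@le_trans _ _ (c * ((8 ^+ (M + j))^-1 * calderon (rearr z) t))).
    by apply: ler_wpM2l; [exact: ltW|exact: yS].
  rewrite mulrA /B [leRHS]mulrAC; apply: ler_wpM2r => //.
  rewrite /c natrX exprS exprD invfM mulrACA.
  rewrite ler_wpM2l ?divr_ge0 ?exprn_ge0//.
  rewrite ler_pdivrMr ?exprn_gt0// -exprMn lerXn2r ?nnegrE//; lra.
have EM M : E ((4 / 8 ^+ M) \*o z) by exact: (qn_scale qnE).
have GM M : G (x \- v M).
  by apply: calderon_spaceI (EM M) (key M); exact: L0B.
have nM M : nG (x \- v M) <= 4 / 8 ^+ M * nE z.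
  rewrite (le_trans (calderon_norm_le (EM M) (key M)))//.
  by rewrite (qn_homogeneous qnE)// ger0_norm// divr_ge0// exprn_ge0.
have Gx : G x.
  rewrite (_ : x = (x \- v 0%N) \+ v 0%N); last first.
    by apply/funext => t /=; rewrite subrK.
  exact: calderon_space_add.
exists x => //.
have [C C1 HC] := qn_triangle_ge1 qnG.
have C0 : 0 < C by exact: lt_le_trans C1.
have cM : (4 / 8 ^+ M * nE z) @[M --> \oo] --> (0 : R).
  rewrite (_ : (fun _ => _) = fun M => 4 * nE z * 8^-1 ^+ M); last first.
    by apply/funext => M; rewrite exprVn mulrAC.
  rewrite -(mulr0 (4 * nE z)); apply: cvgMr.
  by apply: cvg_expr; rewrite ger0_norm// invf_lt1// ltr1n.
have ce : e M @[M --> \oo] --> (0 : R).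
  apply: cvg_expr; rewrite ger0_norm ?divr_ge0 ?(ltW q0)//.
  by rewrite ltr_pdivrMr// mul1r (lt_trans q1)// ltr1n.
apply/cvgrPdist_lt => eps eps0.
have h0 : 0 < eps / (2 * C) by rewrite divr_gt0// mulr_gt0.
have /cvgrPdist_lt/(_ _ h0)[M1 _ HM1] := cM.
have /cvgrPdist_lt/(_ _ h0)[M2 _ HM2] := ce.
pose M := maxn M1 M2.
exists (N M) => // n /= Nn; rewrite sub0r normrN ger0_norm ?calderon_norm_ge0//.
have -> : u n \- x = (u n \- v M) \+ (v M \- x).
  by apply/funext => t /=; rewrite addrA subrK.
apply: (le_lt_trans (HC _ _ _ _)); [exact: (qn_B qnG)|exact: (qn_B qnG)|].
rewrite (qn_normB qnG (Gv M) Gx).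
have l1 : nG (u n \- v M) < eps / (2 * C).
  apply: (lt_le_trans (HN M _ _ Nn (Nphi M))).
  have := HM2 M (leq_maxr _ _); rewrite sub0r normrN => /ltW.
  exact/le_trans/ler_norm.
have l2 : nG (x \- v M) < eps / (2 * C).
  apply: (le_lt_trans (nM M)).
  have := HM1 M (leq_maxl _ _); rewrite sub0r normrN.
  exact/le_lt_trans/ler_norm.
rewrite -ltr_pdivlMl//; apply: (lt_le_trans (ltrD l1 l2)).
by rewrite invfM mulrA -mulrDl -splitr mulrC.
Qed.

Lemma calderon_quasi_banach_symmetric : quasi_banach_symmetric G nG.
Proof.
split.
- exact: calderon_quasi_normed.
- exact: calderon_complete.
- move=> x y Gx my xy; apply: calderon_space_mono => // t /andP[t0 _].
  by apply: le_rearr => //; exact: G_L0.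
- by move=> x y Gx my xy; exact: eq_calderon_space.
Qed.

Lemma calderon_linear : linear_on E calderon.
Proof.
move=> a x y Ex Ey; apply: ae01W => t /I01P t01.
rewrite calderonD ?calderonZ//; try exact: EL1.
by apply: L1Z; exact: EL1.
Qed.

(** The Calderon operator is bounded with constant 1, because [x] itself
    dominates its image. *)
Lemma calderon_bounded : bounded_operator calderon E nE G nG.
Proof.
have dom x : E x -> calderon_dominated (calderon x) x.
  move=> Ex t t01; apply: rearr_calderon_le => //; first exact: EL1.
  exact: L1_rearr.
split=> [x Ex|].
  exact: (calderon_spaceI (L0_calderon (EL1 Ex)) Ex (dom _ Ex)).
by exists 1 => x Ex; rewrite mul1r; apply: calderon_norm_le => //; exact: dom.
Qed.

(** A symmetric space into which the Calderon operator maps [E] contains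
    [calderon (rearr y)] for each [y] of [E], hence everything that it
    dominates. *)
Lemma calderon_minimal F nF : quasi_banach_symmetric F nF ->
  bounded_operator calderon E nE F nF -> G `<=` F.
Proof.
move=> symF [EF _] x /calderon_spaceP[mx [y [Ey xy]]].
have [Ery _] := qbs_rearr symE Ey.
apply: (qbs_rearrK symF) => //.
have [] // := qbs_ideal symF (EF _ Ery) (L0_rearr mx).
apply: ae01W => t /I01P t01; rewrite !ger0_norm ?rearr_ge0//.
  exact: xy.
exact: calderon_rearr_ge0.
Qed.

End CalderonSpace.

Theorem theorem16 (R : realType) (E : set (R -> R)) (normE : (R -> R) -> R)
  (symE : quasi_banach_symmetric E normE) (E_sub_L1 : E `<=` L1) :
  quasi_banach_symmetric (calderon_space E) (calderon_norm E normE) /\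
  optimal_symmetric_range calderon E normE
    (calderon_space E) (calderon_norm E normE).
Proof.
have symG := calderon_quasi_banach_symmetric symE E_sub_L1.
split=> //; split=> //.
- exact: calderon_linear.
- exact: calderon_bounded.
- exact: calderon_minimal.
Qed.
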